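(* Let $k\ge 2$ be an integer, let $q\ne 2$ be a prime, and let $\mathcal{G}=\langle r,s : s^{2}=r^{2^kq}=e,\ srs^{-1}=r^{2^{k-1}q-1}\rangle$. Let $\lambda_1(A(P(\mathcal{G})))$ be the largest eigenvalue of the adjacency matrix of the power graph $P(\mathcal{G})$. Then $$\frac{2^{k-1}(q-1)+n_1}{2}\ \le\ \lambda_1(A(P(\mathcal{G})))\ \le\ 2^{k-1}q-1+\sqrt{2^kq}+\frac{\sqrt{(2^kq)^2-2^{k+1}+1}+\sqrt{1+2^{k+1}q}}{2},$$ where $n_1=\sqrt{2^{2k+1}q(q-1)-3\cdot 2^{2k-2}(q-1)^2+2^{k+2}-4}$.
   Context: The power graph $P(\Omega)$ of a group $\Omega$ is the simple graph with vertex set $\Omega$ in which two distinct elements $u,v$ are adjacent iff $u=v^m$ or $v=u^n$ for some positive integers $m,n$. *)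

(* Defs.v *)
From mathcomp Require Export all_boot all_order all_algebra all_fingroup all_solvable.
From mathcomp Require Export boolp reals.

Set Implicit Arguments.
Unset Strict Implicit.
Unset Printing Implicit Defensive.

Import Order.TTheory GRing.Theory Num.Theory.

Definition power_graph (gT : finGroupType) : rel gT := fun u v =>
  (u != v) &&
  `[< (exists m : nat, (0 < m)%N /\ u = (v ^+ m)%g) \/
      (exists n : nat, (0 < n)%N /\ v = (u ^+ n)%g) >].

(* Vertices are numbered by [enum_val]; the spectrum does not depend on the
   numbering. *)
Definition adjacency_mx (R : realType) (T : finType) (e : rel T)
    : 'M[R]_#|T| :=
  (\matrix_(i, j) (e (enum_val i) (enum_val j))%:R)%R.

Definition is_largest_eigenvalue (R : realType) (n : nat) (A : 'M[R]_n)
    (l : R) : Prop :=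
  eigenvalue A l /\ (forall a : R, eigenvalue A a -> (a <= l)%R).

(* Main.v *)
Require Import Defs.
From mathcomp Require Import spectral complex sesquilinear.
From mathcomp Require Import zify ring lra.

(** Write n = 2^k q and let C = <r>. The action of s on C has order two, so the
    presented group is a split extension of a cyclic group of order n by an
    involution; its order is 2n, which forces #[r] = n. Outside C every element
    is some r^i s, whose square is r^(i n/2), an element of C of order at most
    two. So a vertex x outside C has only the neighbours 1, x^2 (both in C) and
    x^-1 (outside C).

    Upper bound. A positive weight w with A w <= mu w bounds all eigenvalues of
    the nonnegative matrix A by mu ([eigenvalue_le_supersolution]). With w = 1
    on C and w = 2/n outside C, the inequality holds for mu = n + 1: a vertex of
    C sees at most (n - 1) + n * (2/n), and one outside sees at most
    2 + 2/n = (n + 1) * (2/n). The bound in the theorem exceeds n + 1, because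
    n >= 12 makes its first square root at least 3 and its last at least 5,
    while the middle one is at least n - 1.

    Lower bound. The identity and the M = phi(n) = 2^(k-1) (q - 1) generators of
    C are adjacent to all of C, so the power graph contains the join of a
    complete graph on M + 1 vertices with n - M - 1 isolated ones. The largest
    eigenvalue of that join is the positive root of
    mu^2 = M mu + (M + 1) (n - M - 1); since n - 2 M = 2^k, this root is
    (M + n1) / 2. Its eigenvector, extended by zero, is a nonnegative vector
    with A w >= mu w, and the Rayleigh quotient of w is then at least mu
    ([adjacency_largest_eigenvalue_ge]). *)

Set Implicit Arguments.
Unset Strict Implicit.
Unset Printing Implicit Defensive.

Import Order.TTheory GRing.Theory Num.Theory.

Local Open Scope ring_scope.
Local Open Scope sesquilinear_scope.

(** * Eigenvalues of nonnegative and of symmetric matrices *)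

(** This is one half of the Collatz-Wielandt principle: at an index j where
    |v_j| / w_j is largest, for an eigenvector v, the eigenvalue equation at j is
    dominated by the inequality satisfied by w. *)
Lemma eigenvalue_le_supersolution (R : realFieldType) (n : nat) (A : 'M[R]_n)
    (w : 'I_n -> R) (mu a : R) :
  (forall i j, 0 <= A i j) -> (forall i, 0 < w i) ->
  (forall j, \sum_i w i * A i j <= mu * w j) ->
  eigenvalue A a -> a <= mu.
Proof.
move=> A_ge0 w_gt0 Aw /eigenvalueP [v vA v_neq0].
have [j0 vj0] : exists j, v 0 j != 0.
  apply/existsP; apply: contraNT v_neq0 => /existsPn v0.
  by apply/eqP/rowP => j; rewrite mxE; apply/eqP; move: (v0 j); rewrite negbK.
pose M i := `|v 0 i| / w i.
have [j _ maxM] := arg_maxP M (isT : xpredT j0).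
have w_neq0 i : w i != 0 by rewrite gt_eqF.
have vM i : `|v 0 i| = M i * w i by rewrite /M divfK.
have Mj_gt0 : 0 < M j.
  by apply: lt_le_trans (maxM j0 isT); rewrite divr_gt0 ?normr_gt0.
have vAj : a * v 0 j = \sum_i v 0 i * A i j.
  by move/rowP/(_ j): vA; rewrite !mxE => <-.
suff : a * (M j * w j) <= mu * (M j * w j).
  by rewrite ler_pM2r // mulr_gt0.
rewrite -vM; apply: le_trans (_ : `|a * v 0 j| <= _).
  by rewrite normrM ler_wpM2r // ler_norm.
rewrite vAj; apply: le_trans (ler_norm_sum _ _ _) _.
apply: le_trans (_ : M j * \sum_i w i * A i j <= _).
  rewrite mulr_sumr; apply: ler_sum => i _.
  rewrite normrM vM (ger0_norm (A_ge0 i j)) mulrA ler_wpM2r //.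
  by apply: ler_wpM2r; [apply: ltW | apply: maxM].
by rewrite vM mulrCA ler_wpM2l // ltW.
Qed.

(** A real symmetric matrix becomes Hermitian over R[i], where the spectral
    theorem diagonalizes it in an orthonormal basis with real eigenvalues; these
    are eigenvalues over R as well. The Rayleigh inequality for the greatest of
    them holds coordinatewise in that basis, and applied to an eigenvector it
    shows that no eigenvalue is greater. *)
Lemma symmetric_largest_eigenvalue (R : realType) (n : nat) (A : 'M[R]_n) :
  (0 < n)%N -> A^T = A ->
  exists2 l : R, is_largest_eigenvalue A l &
    forall x : 'rV[R]_n, (x *m A *m x^T) 0 0 <= l * (x *m x^T) 0 0.
Proof.
move=> n_gt0 symA; pose toC := real_complex R; pose Ac := map_mx toC A.
have realAc : Ac \is a mxOver Num.real.
  by apply/mxOverP => i j; rewrite mxE; rewrite complex_real.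
have hermAc : Ac \is hermsymmx.
  apply: realsym_hermsym realAc; apply/is_hermitianmxP.
  by rewrite expr0 scale1r map_mx_id // map_trmx symA.
pose P := spectralmx Ac; pose D := spectral_diag Ac.
have unitP : P \is unitarymx by apply: spectral_unitarymx.
have AcE : Ac = P^t* *m diag_mx D *m P.
  rewrite -(invmx_unitary unitP); apply/orthomx_spectralP.
  exact: hermitian_normalmx.
have PA : P *m Ac = diag_mx D *m P.
  by rewrite {1}AcE !mulmxA (unitarymxP unitP) mul1mx.
pose d i := complex.Re (D 0 i).
have dE i : D 0 i = toC (d i).
  have /mxOverP/(_ 0 i) := hermitian_spectral_diag_real hermAc.
  by rewrite /d /toC => /RRe_real ->.
have eig_d i : eigenvalue A (d i).
  suff : eigenvalue Ac (D 0 i) by rewrite dE eigenvalue_map.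
  apply/eigenvalueP; exists (row i P).
    by rewrite -row_mul PA; apply/rowP => j; rewrite mxE mul_diag_mx !mxE.
  apply/eqP => Pi0; have /matrixP/(_ i i) := unitarymxP unitP.
  rewrite !mxE eqxx big1 => [/eqP|j _]; first by rewrite eq_sym oner_eq0.
  by move/rowP/(_ j): Pi0; rewrite !mxE => ->; rewrite mul0r.
have [m _ max_m] := arg_maxP d (isT : xpredT (Ordinal n_gt0)).
(* In the coordinates y of x, both quadratic forms are diagonal. *)
have rayleigh (x : 'rV[R]_n) :
    (x *m A *m x^T) 0 0 <= d m * (x *m x^T) 0 0.
  pose y := map_mx toC x *m P^t*.
  have yP : map_mx toC x = y *m P by rewrite mulmxKtV.
  have xt : map_mx toC x^T = P^t* *m y^t*.
    rewrite -map_mxM -trmx_mul -yP map_trmx; apply/matrixP => i j.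
    by rewrite !mxE; symmetry; apply/CrealP; rewrite complex_real.
  have yxA : toC ((x *m A *m x^T) 0 0) = (y *m diag_mx D *m y^t*) 0 0.
    transitivity ((map_mx toC (x *m A *m x^T)) 0 0); first by rewrite !mxE.
    rewrite !map_mxM xt yP -/Ac !mulmxA -(mulmxA y) PA mulmxA.
    by rewrite -[_ *m P *m _]mulmxA (unitarymxP unitP) mulmx1.
  have yx : toC ((x *m x^T) 0 0) = (y *m y^t*) 0 0.
    transitivity ((map_mx toC (x *m x^T)) 0 0); first by rewrite !mxE.
    rewrite !map_mxM xt yP !mulmxA -[_ *m P *m _]mulmxA.
    by rewrite (unitarymxP unitP) mulmx1.
  suff : toC ((x *m A *m x^T) 0 0) <= toC (d m) * toC ((x *m x^T) 0 0).
    by rewrite -rmorphM /= lecR.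
  rewrite yxA yx !mxE mulr_sumr.
  apply: ler_sum => i _; rewrite mul_mx_diag !mxE dE mulrAC mulrC.
  apply: ler_wpM2r; first exact: mul_conjC_ge0.
  by rewrite lecR; apply: max_m.
exists (d m) => //; split=> // a /eigenvalueP [v vA v_neq0].
have := rayleigh v; rewrite vA -scalemxAl [in leLHS]mxE ler_pM2r //.
rewrite mxE; under eq_bigr do rewrite mxE -expr2.
rewrite lt_def sumr_ge0 ?andbT => [|i _]; last exact: sqr_ge0.
apply: contraNneq v_neq0 => /psumr_eq0P v0; apply/eqP/rowP => i.
by rewrite mxE; apply/eqP; rewrite -sqrf_eq0 v0 // => j _; apply: sqr_ge0.
Qed.

(** * Eigenvalue bounds for graphs *)

Section Adjacency.
Variables (R : realType) (T : finType) (e : rel T).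
Implicit Types (f w : T -> R).

Lemma adjacency_sum f (j : 'I_#|T|) :
  \sum_i f (enum_val i) * adjacency_mx R e i j
    = \sum_(u | e u (enum_val j)) f u.
Proof.
rewrite [RHS]big_mkcond (reindex (@enum_val T T)) /=; last first.
  by exists enum_rank => i _; rewrite ?enum_valK ?enum_rankK.
by apply: eq_bigr => i _; rewrite mxE; case: ifP; rewrite ?mulr1 ?mulr0.
Qed.

Lemma adjacency_eigenvalue_le w (mu a : R) :
  (forall u, 0 < w u) -> (forall v, \sum_(u | e u v) w u <= mu * w v) ->
  eigenvalue (adjacency_mx R e) a -> a <= mu.
Proof.
move=> w_gt0 w_super.
apply: (@eigenvalue_le_supersolution _ _ _ (w \o enum_val)) => [i j|i|j] /=.
- by rewrite mxE ler0n.
- exact: w_gt0.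
- by rewrite adjacency_sum.
Qed.

Hypothesis sym_e : symmetric e.

Lemma adjacency_mx_sym : (adjacency_mx R e)^T = adjacency_mx R e.
Proof. by apply/matrixP => i j; rewrite !mxE sym_e. Qed.

(** Multiplying the hypothesis on [w] by [w v] and summing over [v] says that
    the Rayleigh quotient of [w] is at least [mu]. *)
Lemma adjacency_largest_eigenvalue_ge w (mu l : R) (u0 : T) :
  is_largest_eigenvalue (adjacency_mx R e) l ->
  (forall u, 0 <= w u) -> w u0 != 0 ->
  (forall v, mu * w v <= \sum_(u | e u v) w u) -> mu <= l.
Proof.
move=> [_ l_max] w_ge0 wu0 w_sub.
have T_gt0 : (0 < #|T|)%N by apply/card_gt0P; exists u0.
have [l' [eig_l' _] rayleigh] :=
  symmetric_largest_eigenvalue T_gt0 adjacency_mx_sym.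
apply: le_trans (l_max _ eig_l').
pose x : 'rV[R]_#|T| := \row_i w (enum_val i).
have xx : 0 < (x *m x^T) 0 0.
  rewrite mxE (bigD1 (enum_rank u0)) //= !mxE enum_rankK.
  rewrite ltr_wpDr ?sumr_ge0 // => [i _|]; first by rewrite !mxE mulr_ge0.
  by rewrite lt_def mulf_neq0 // mulr_ge0.
rewrite -(ler_pM2r xx); apply: le_trans (rayleigh x).
rewrite !mxE mulr_sumr; apply: ler_sum => j _.
rewrite mxE [in leRHS]mxE [x^T j 0]mxE [x 0 j]mxE mulrA.
rewrite ler_wpM2r //; under eq_bigr do rewrite [x _ _]mxE.
by rewrite adjacency_sum.
Qed.

(** The graph contains the join of a complete graph on [U] with the empty graph
    on [C :\: U]. With equality, the condition on [mu] is the characteristic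
    equation of that join, whose eigenvector is [mu] on [U] and [#|U|] on
    [C :\: U]; this vector is the test weight. *)
Lemma dominated_subgraph_le (U C : {set T}) (mu l : R) :
  is_largest_eigenvalue (adjacency_mx R e) l ->
  U \subset C -> (0 < #|U|)%N -> {in U & C, forall u v, u != v -> e u v} ->
  0 <= mu ->
  mu ^+ 2 <= (#|U|%:R - 1) * mu + #|U|%:R * (#|C|%:R - #|U|%:R) ->
  mu <= l.
Proof.
move=> l_max subUC U_gt0 domU mu_ge0 mu2.
(* For mu = 0 that weight may vanish; a constant one then works. *)
have [mu0|mu_neq0] := eqVneq mu 0.
  have /card_gt0P[u0 _] := U_gt0.
  apply: (@adjacency_largest_eigenvalue_ge (fun=> 1) _ _ u0 l_max) => //.
    by rewrite oner_eq0.
  by move=> v; rewrite mu0 mul0r sumr_ge0.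
pose w u : R := if u \in U then mu else if u \in C then #|U|%:R else 0.
have w_ge0 u : 0 <= w u by rewrite /w; case: ifP => // _; case: ifP.
have /card_gt0P[u0 u0U] := U_gt0.
have wE (P : pred T) : {in P, forall u, u \in C} ->
    \sum_(u | P u) w u = #|[set u in U | P u]|%:R * mu
      + #|[set u in C :\: U | P u]|%:R * #|U|%:R.
  move=> PC; rewrite (bigID (mem U)) /= !mulr_natl.
  rewrite -(sumr_const _ mu) -(sumr_const _ #|U|%:R); congr (_ + _).
    by apply: eq_big => [u|u /andP[_ uU]]; rewrite ?inE 1?andbC // /w uU.
  apply: eq_big => [u|u /andP[Pu uU]].
    by rewrite !inE; case Pu: (P u); rewrite ?andbF // (PC _ Pu) !andbT.
  by rewrite /w (negPf uU) PC.
apply: (@adjacency_largest_eigenvalue_ge w _ _ u0 l_max) => // [|v].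
  by rewrite /w u0U.
have sum_ge (P : pred T) : {in P, forall u, e u v} ->
    \sum_(u | P u) w u <= \sum_(u | e u v) w u.
  move=> Pe; rewrite [leLHS]big_mkcond [leRHS]big_mkcond /=.
  apply: ler_sum => u _; case: ifP => [Pu|_]; first by rewrite (Pe _ Pu).
  by case: ifP.
rewrite {1}/w; case: ifP => [vU|vU]; last first.
  case: ifP => [vC|_]; last by rewrite mulr0 sumr_ge0.
  apply: le_trans (sum_ge (mem U) _); last first.
    by move=> u uU; apply: domU => //; apply: contraFneq vU => <-.
  rewrite (eq_bigr (fun=> mu)) => [|u /= uU]; last by rewrite /w uU.
  by rewrite sumr_const mulr_natr.
have vC := subsetP subUC v vU.
apply: le_trans (sum_ge [pred u in C | u != v] _); last first.
  by move=> u /andP[uC uv]; rewrite sym_e domU // eq_sym.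
rewrite wE => [|u /andP[]//]; rewrite -expr2.
apply: le_trans mu2 _; rewrite lerD //.
  rewrite ler_wpM2r // lerBlDr natr1 ler_nat.
  rewrite (cardsD1 v U) vU add1n ltnS subset_leq_card //.
  apply/subsetP => u; rewrite !inE => /andP[uv uU].
  by rewrite uU uv (subsetP subUC).
rewrite mulrC ler_wpM2r // lerBlDr -natrD ler_nat addnC -leq_subLR.
rewrite -{1}(setIidPr subUC) -cardsD subset_leq_card //.
apply/subsetP => u; rewrite !inE => /andP[uU uC].
by rewrite uU uC; apply: contraNneq uU => ->.
Qed.

(** The weight is 1 on [C] and [b] outside. A vertex of [C] sees at most
    [n - 1 + n * b] and an outer one at most [2 + b], where [n = #|C|]; both are
    at most [n + 1] times the weight of the vertex exactly when [b = 2 / n]. *)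
Lemma half_graph_eigenvalue_le (C : {set T}) (a : R) :
  irreflexive e -> (#|~: C| <= #|C|)%N ->
  (forall v, v \notin C -> #|[set u in C | e u v]| <= 2)%N ->
  (forall v, v \notin C -> #|[set u in ~: C | e u v]| <= 1)%N ->
  eigenvalue (adjacency_mx R e) a -> a <= #|C|%:R + 1.
Proof.
move=> irr_e C_half degC degC'.
pose n : R := #|C|%:R; pose b := 2 / n.
have [C0|C_gt0] := posnP #|C|.
  case/eigenvalueP => x _ /eqP[]; apply/rowP => j.
  move: C_half; rewrite C0 leqn0 => /eqP C'0.
  have := cardsC C; rewrite C0 C'0 => T0; suff : (j < 0)%N by [].
  by rewrite [X in (_ < X)%N]T0 ltn_ord.
have n_gt0 : 0 < n by rewrite ltr0n.
have b_gt0 : 0 < b by rewrite divr_gt0.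
have nb : n * b = 2 by rewrite mulrC divfK // gt_eqF.
pose w u : R := if u \in C then 1 else b.
apply: (@adjacency_eigenvalue_le w) => [u|v]; first by rewrite /w; case: ifP.
have -> : \sum_(u | e u v) w u
    = #|[set u in C | e u v]|%:R + #|[set u in ~: C | e u v]|%:R * b.
  rewrite (bigID (mem C)) /= mulr_natl -!sumr_const; congr (_ + _).
    by apply: eq_big => [u|u /andP[_ uC]]; rewrite ?inE 1?andbC // /w uC.
  by apply: eq_big => [u|u /andP[_ uC]]; rewrite ?inE 1?andbC // /w (negPf uC).
rewrite /w -/n; case: (boolP (v \in C)) => vC.
  have inC : #|[set u in C | e u v]|%:R <= n - 1.
    rewrite lerBrDr natr1 ler_nat (cardsD1 v C) vC add1n ltnS.
    rewrite subset_leq_card //.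
    apply/subsetP => u; rewrite !inE => /andP[-> euv].
    by rewrite andbT; apply: contraTneq euv => ->; rewrite irr_e.
  have outC : #|[set u in ~: C | e u v]|%:R * b <= n * b.
    rewrite ler_wpM2r ?(ltW b_gt0) // ler_nat; apply: leq_trans C_half.
    by apply/subset_leq_card/subsetP => u; rewrite inE => /andP[].
  by lra.
have inC : #|[set u in C | e u v]|%:R <= 2%:R :> R by rewrite ler_nat degC.
have outC : #|[set u in ~: C | e u v]|%:R * b <= b.
  by rewrite -[leRHS]mul1r ler_wpM2r ?(ltW b_gt0) // lern1 degC'.
by rewrite mulrDl nb; lra.
Qed.

End Adjacency.

(** * Adjacency in power graphs *)

Section PowerGraph.
Variable gT : finGroupType.
Local Open Scope group_scope.

Lemma power_graph_sym : symmetric (@power_graph gT).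
Proof.
move=> u v; rewrite /power_graph eq_sym; congr (_ && _).
by apply: asbool_equiv_eq; rewrite or_comm.
Qed.

Lemma power_graph_irr : irreflexive (@power_graph gT).
Proof. by move=> u; rewrite /power_graph eqxx. Qed.

Lemma power_graph_cycle (u v : gT) :
  v \in <[u]> -> u != v -> power_graph u v.
Proof.
move=> /cycleP[i ->] neq; rewrite /power_graph neq; apply/asboolP; right.
(* The exponent has to be positive. *)
exists (i + #[u])%N; split; first by rewrite addn_gt0 order_gt0 orbT.
by rewrite expgD expg_order mulg1.
Qed.

(** The powers of an element x outside [C] are 1, x, x^2 and x^-1, and only x
    and x^-1 lie outside [C]. Hence if x is a power of some y, then y lies
    outside [C] too, and x = y or x = y^-1. *)
Lemma power_graph_outside (C : {group gT}) (u v : gT) :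
  {in ~: C, forall x, x ^+ 2 \in C /\ x ^+ 4 = 1} ->
  u \notin C -> power_graph v u ->
  if v \in C then v \in [set 1; u ^+ 2] else v == u^-1.
Proof.
move=> C4 uC.
have powers x m : x \notin C -> [\/ x ^+ m = x,
    x ^+ m \in C /\ x ^+ m \in [set 1; x ^+ 2] | x ^+ m = x^-1].
  move=> xC; have [x2C x4] : x ^+ 2 \in C /\ x ^+ 4 = 1.
    by apply: C4; rewrite inE.
  have -> : x ^+ m = x ^+ (m %% 4).
    by rewrite {1}(divn_eq m 4) expgD mulnC expgM x4 expg1n mul1g.
  have : (m %% 4 < 4)%N by rewrite ltn_mod.
  case: (m %% 4)%N => [|[|[|[|//]]]] _.
  - by apply: Or32; rewrite !inE eqxx group1.
  - exact: Or31.
  - by apply: Or32; rewrite !inE eqxx orbT.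
  - by apply: Or33; apply/eqP; rewrite eq_sym eq_invg_mul -expgS x4.
case/andP=> neq /asboolP [[m [_ vu]]|[n [_ uv]]].
- rewrite vu in neq *; have [um|[-> ->]//|->] := powers u m uC.
    by rewrite um eqxx in neq.
  by rewrite groupV (negPf uC).
have vC : v \notin C by apply: contra uC => vC; rewrite uv groupX.
rewrite (negPf vC); have := powers v n vC; rewrite -uv => -[uv'|[uC' _]|->].
- by rewrite uv' eqxx in neq.
- by rewrite uC' in uC.
- by rewrite invgK.
Qed.

Lemma card_dominating_set (r : gT) : r != 1 ->
  #|1 |: [set x | generator <[r]> x]| = (totient #[r]).+1.
Proof.
move=> r_neq1; rewrite cardsU1 totient_gen inE /generator cycle1 cycle_eq1.
by rewrite (negPf r_neq1) add1n.
Qed.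

End PowerGraph.

(** * The group defined by the presentation *)

Section SplitExtension.
Local Open Scope group_scope.

(** The model is the semidirect product of Z/n and Z/2 in which the involution
    raises to the power c; this is an action because c^2 = 1 modulo n. It keeps
    the presented group from collapsing. *)
Lemma card_cyclic_by_involution_model (n c : nat) :
  (1 < n)%N -> (c * c = 1 %[mod n])%N ->
  exists (E : finGroupType) (x y : E),
    [/\ #|[set: E]| = (2 * n)%N, <[x]> <*> <[y]> = [set: E],
        x ^+ n = 1, y ^+ 2 = 1 & x ^ y = x ^+ c].
Proof.
move=> n_gt1 c2; pose E := Extremal.gtype n 2 c.
have cop_c : coprime n c.
  have : coprime n (c * c) by rewrite -coprime_modr c2 coprime_modr coprimen1.
  by rewrite coprimeMr => /andP[].
have isoE : [set: E] \isog Grp (x : y : x ^+ n, y ^+ 2, x ^ y = x ^+ c).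
  apply: Extremal.Grp => //; set b := Zp1.
  have ob : #[b : 'Z_n] = n by rewrite order_Zp1 Zp_cast.
  have unit_c : (c%:R : 'Z_#[b]) \is a GRing.unit.
    by rewrite unitZpE ?ob.
  pose uc := FinRing.unit 'Z_#[b] unit_c.
  have vc : (val uc : nat) = c %[mod #[b]].
    by rewrite /= val_Zp_nat ?modn_mod // ob.
  exists (Zp_unitm uc).
  rewrite Aut_aut order_injm ?injm_Zp_unitm ?in_setT //; split=> //.
    rewrite order_dvdn -val_eqE /= -natrM; apply/eqP.
    rewrite -[1%R]/(1%:R)%R; apply: val_inj.
    rewrite /= !val_Zp_nat ?ob // (Zp_cast n_gt1).
    exact: c2.
  by apply/eqP; rewrite autE ?cycle_id // eq_expg_mod_order vc.
have /existsP[[x y] /eqP[defE xn y2 xy]] : [set: E] \homg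
    Grp (x : y : x ^+ n, y ^+ 2, x ^ y = x ^+ c) by rewrite -isoE homg_refl.
by exists E, x, y; rewrite Extremal.card.
Qed.

(** The presented group maps onto the model, so its order is at least 2n; as it
    is also the product of <[r]> and <[s]>, equality holds throughout. *)
Lemma cyclic_by_involution_structure (n c : nat) (gT : finGroupType) :
  (1 < n)%N -> (c * c = 1 %[mod n])%N ->
  [set: gT] \isog Grp (r : s : s ^+ 2 = r ^+ n = 1, s * r * s^-1 = r ^+ c) ->
  exists r s : gT,
    [/\ #[r] = n, s ^+ 2 = 1, s * r * s^-1 = r ^+ c, #|[set: gT]| = (2 * n)%N
      & forall u, u \notin <[r]> -> exists i, u = r ^+ i * s].
Proof.
move=> n_gt1 c2 isoG.
have [E [x [y [cardE genE xn y2 xy]]]] :=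
  card_cyclic_by_involution_model n_gt1 c2.
have leG : (2 * n <= #|[set: gT]|)%N.
  have EG : [set: E]%G \homg [set: gT].
    rewrite isoG; apply/existsP; exists (x, y); rewrite /= !xpair_eqE.
    have yV : y^-1 = y by apply/eqP; rewrite eq_invg_mul -y2.
    by rewrite genE xn y2 -xy conjgE yV mulgA !eqxx.
  by rewrite -cardE; apply: leq_homg EG.
have /existsP[[r s] /eqP[defG s2 rn sr]] : [set: gT] \homg
  Grp (r : s : s ^+ 2 = r ^+ n = 1, s * r * s^-1 = r ^+ c)
  by rewrite -isoG homg_refl.
have sV : s^-1 = s by apply/eqP; rewrite eq_invg_mul -s2.
have norm_rs : <[s]> \subset 'N(<[r]>).
  by rewrite norms_cycle conjgE -{2}[s]sV sV -{2}[s]sV mulgA sr mem_cycle.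
have mulG : <[r]> * <[s]> = [set: gT] by rewrite -norm_joinEr.
have os : (#[s] <= 2)%N by rewrite dvdn_leq // order_dvdn s2.
have or : (#[r] <= n)%N by rewrite dvdn_leq ?(ltnW n_gt1) // order_dvdn rn.
have cardG : (#|[set: gT]| <= #[r] * #[s])%N.
  by rewrite -mulG /order mul_cardG leq_pmulr ?cardG_gt0.
exists r, s; split=> //.
- by apply/eqP; rewrite eqn_leq or /=; nia.
- by apply/eqP; rewrite eqn_leq leG andbT; nia.
move=> u u_out; have : u \in <[r]> * <[s]> by rewrite mulG inE.
case/mulsgP => _ _ /cycleP[i ->] /cycleP[j ->] uE; exists i.
have sj : s ^+ j = if odd j then s else 1.
  rewrite -{1}(odd_double_half j) expgD -mul2n expgM s2 expg1n mulg1.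
  by case: (odd j).
by move: uE u_out; rewrite sj; case: ifP => // _ ->; rewrite mulg1 mem_cycle.
Qed.

Lemma semidihedral_square (gT : finGroupType) (m : nat) (r s : gT) (i : nat) :
  (0 < m)%N -> s ^+ 2 = 1 -> s * r * s^-1 = r ^+ (m - 1) ->
  (r ^+ i * s) ^+ 2 = r ^+ (m * i).
Proof.
move=> m_gt0 s2 sr; have sV : s^-1 = s by apply/eqP; rewrite eq_invg_mul -s2.
have conj_s : s * r ^+ i * s^-1 = r ^+ ((m - 1) * i).
  have := conjXg r s^-1 i; rewrite !conjgE invgK !mulgA => ->.
  by rewrite sr expgM.
transitivity (r ^+ i * (s * r ^+ i * s^-1)).
  by rewrite sV expgS expg1 !mulgA.
by rewrite conj_s -expgD -mulSn subn1 prednK.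
Qed.
End SplitExtension.

(** * Bounds for power graphs, and the theorem *)

Lemma power_graph_eigenvalue_le (R : realType) (gT : finGroupType)
    (C : {group gT}) (a : R) :
  (#|~: C| <= #|C|)%N ->
  {in ~: C, forall x, x ^+ 2 \in C /\ x ^+ 4 = 1}%g ->
  eigenvalue (adjacency_mx R (@power_graph gT)) a -> a <= #|C|%:R + 1.
Proof.
move=> C_half C4; apply: half_graph_eigenvalue_le => // [|u uC|u uC].
- exact: power_graph_irr.
- apply: leq_trans (_ : #|[set 1; u ^+ 2]%g| <= 2)%N; last first.
    by rewrite cards2; case: eqP.
  apply/subset_leq_card/subsetP => v; rewrite inE => /andP[vC].
  by move/(power_graph_outside C4 uC); rewrite vC.
- rewrite -(cards1 u^-1%g); apply/subset_leq_card/subsetP => v.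
  rewrite !inE => /andP[vC].
  by move/(power_graph_outside C4 uC); rewrite (negPf vC).
Qed.

(** The dominating set consists of the identity and the generators of <[r]>,
    which are adjacent to every other element of <[r]>. *)
Lemma power_graph_largest_eigenvalue_ge (R : realType) (gT : finGroupType)
    (r : gT) (mu l : R) :
  is_largest_eigenvalue (adjacency_mx R (@power_graph gT)) l ->
  r != 1%g -> 0 <= mu ->
  mu ^+ 2 <= (totient #[r]%g)%:R * mu
    + ((totient #[r]%g)%:R + 1) * (#[r]%g%:R - (totient #[r]%g)%:R - 1) ->
  mu <= l.
Proof.
move=> l_max r_neq1 mu_ge0 mu2; pose U := (1 |: [set x | generator <[r]> x])%g.
have cardU : #|U| = (totient #[r]%g).+1 by apply: card_dominating_set.
apply: (@dominated_subgraph_le _ _ _ (@power_graph_sym gT) U <[r]>%g)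
  l_max _ _ _ _ _ => //.
- apply/subsetP => x; rewrite !inE => /orP[/eqP->|/eqP->]; first exact: group1.
  exact: cycle_id.
- by rewrite cardU.
- move=> u v; rewrite !inE => /orP[/eqP->|/eqP gen_u] vr neq.
    by rewrite power_graph_sym power_graph_cycle ?group1 // eq_sym.
  by rewrite power_graph_cycle // -gen_u.
apply: le_trans mu2 _; rewrite cardU -[#|<[r]>%g|]/#[r]%g -natr1.
by rewrite addrK opprD addrA.
Qed.

Lemma totient_two_power_mul (k q : nat) : prime q -> q <> 2%N ->
  totient (2 ^ k.+1 * q) = (2 ^ k * (q - 1))%N.
Proof.
move=> q_pr q_neq2; rewrite totient_coprime; last first.
  rewrite coprimeXl // prime_coprime // dvdn_prime2 //.
  by apply/negP => /eqP; auto.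
by rewrite totient_pfactor // totient_prime // mul1n subn1.
Qed.

Theorem theorem5p3 (R : realType) (k q : nat) (gT : finGroupType) :
  (2 <= k)%N -> prime q -> q <> 2%N ->
  ([set: gT] \isog Grp (r : s :
     s ^+ 2 = r ^+ (2 ^ k * q)%N = 1,
     s * r * s^-1 = r ^+ (2 ^ (k - 1) * q - 1)%N))%g ->
  let Q : R := q%:R in
  let n1 : R :=
    Num.sqrt (2 ^+ (2 * k + 1)%N * Q * (Q - 1)
              - 3 * 2 ^+ (2 * k - 2)%N * (Q - 1) ^+ 2
              + 2 ^+ (k + 2)%N - 4) in
  exists lambda1 : R,
    is_largest_eigenvalue (adjacency_mx R (@power_graph gT)) lambda1 /\
    (2 ^+ (k - 1)%N * (Q - 1) + n1) / 2 <= lambda1 /\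
    lambda1 <= 2 ^+ (k - 1)%N * Q - 1 + Num.sqrt (2 ^+ k * Q)
               + (Num.sqrt ((2 ^+ k * Q) ^+ 2 - 2 ^+ (k + 1)%N + 1)
                  + Num.sqrt (1 + 2 ^+ (k + 1)%N * Q)) / 2.
Proof.
case: k => [|[|k]] // _ q_pr q_neq2 isoG Q n1.
have q_gt2 : (2 < q)%N.
  by rewrite ltn_neqAle prime_gt1 // andbT; apply/eqP => /esym.
pose m := (2 ^ k.+1 * q)%N.
have nE : (2 ^ k.+2 * q)%N = (2 * m)%N by rewrite expnS mulnA.
have m_even : m = (2 * (2 ^ k * q))%N by rewrite /m expnS mulnA.
have m_gt5 : (5 < m)%N.
  have := expn_gt0 2 k; rewrite m_even /= => ?; nia.
have subk : (k.+2 - 1 = k.+1)%N by rewrite subn1.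
move: isoG; rewrite subk nE -/m => isoG.
(* With m = n / 2 = 2 h, the square of m - 1 is 1 + 4 h (h - 1) = 1 + (h - 1) n,
   so s acts on <r> as an involution. *)
have c2 : ((m - 1) * (m - 1) = 1 %[mod 2 * m])%N.
  set h := (2 ^ k * q)%N in m_even.
  have -> : ((m - 1) * (m - 1) = 1 + (h - 1) * (2 * m))%N by nia.
  by rewrite addnC modnMDl.
have n_gt1 : (1 < 2 * m)%N by lia.
have [r [s [or s2 sr cardG out]]] :=
  cyclic_by_involution_structure n_gt1 c2 isoG.
have m_gt0 : (0 < m)%N by lia.
have T_gt0 : (0 < #|gT|)%N by apply/card_gt0P; exists 1%g.
have symA := adjacency_mx_sym R (@power_graph_sym gT).
have [l l_max _] := symmetric_largest_eigenvalue T_gt0 symA.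
exists l; split=> //.
pose K : R := 2 ^+ k.+1.
have K_ge2 : 2 <= K.
  by rewrite /K exprS ler_peMr // -natrX ler1n expn_gt0.
have Q_ge3 : 3 <= Q by rewrite ler_nat.
have mR : m%:R = K * Q by rewrite natrM natrX.
have E2 : 2 ^+ k.+2 = 2 * K by rewrite exprS.
have E3 : 2 ^+ (k.+2 + 1) = 4 * K :> R by rewrite addn1 !exprS /K !exprS; ring.
have KQ : 6 <= K * Q by nra.
split.
  have E4 : 2 ^+ (k.+2 + 2) = 8 * K :> R by rewrite addn2 /K !exprS; ring.
  have E5 : 2 ^+ (2 * k.+2 + 1) = 8 * K ^+ 2 :> R.
    by rewrite addn1 exprS mulnC exprM E2; ring.
  have E6 : 2 ^+ (2 * k.+2 - 2) = K ^+ 2 :> R.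
    by rewrite (_ : (2 * k.+2 - 2 = k.+1 * 2)%N) ?exprM //; lia.
  have tot : (totient #[r]%g)%:R = K * (Q - 1) :> R.
    rewrite or -nE totient_two_power_mul // natrM natrX natrB //.
    exact: prime_gt0.
  have n12 : n1 ^+ 2 = 8 * K ^+ 2 * Q * (Q - 1) - 3 * K ^+ 2 * (Q - 1) ^+ 2
                         + 8 * K - 4.
    rewrite /n1 E4 E5 E6 sqr_sqrtr //.
    (* The radicand is positive, since 8 Q - 3 (Q - 1) = 5 Q + 3. *)
    have -> : 8 * K ^+ 2 * Q * (Q - 1) - 3 * K ^+ 2 * (Q - 1) ^+ 2 + 8 * K - 4
      = K ^+ 2 * (Q - 1) * (5 * Q + 3) + (8 * K - 4) by ring.
    by rewrite addr_ge0 ?mulr_ge0 ?sqr_ge0 //; lra.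
  have n1_ge0 : 0 <= n1 by apply: sqrtr_ge0.
  have M_ge0 : 0 <= K * (Q - 1) by rewrite mulr_ge0 //; lra.
  rewrite -/K; apply: (power_graph_largest_eigenvalue_ge l_max (r := r)).
  - by rewrite -order_eq1 or; apply/eqP; lia.
  - by rewrite divr_ge0 // addr_ge0.
  rewrite tot or natrM mR le_eqVlt; apply/orP; left; apply/eqP.
  by rewrite expr_div_n sqrrD n12; field.
have upper : l <= #|<[r]>%g|%:R + 1.
  apply: power_graph_eigenvalue_le (proj1 l_max).
    by rewrite cardsCs setCK -cardsT cardG /= -[#|<[r]>%g|]/#[r]%g or; lia.
  move=> u; rewrite inE => /out[i ->].
  rewrite -[4%N]/(2 * 2)%N expgM (semidihedral_square i m_gt0 s2 sr) mem_cycle.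
  by split=> //; rewrite -expgM mulnC mulnA -or expgM expg_order expg1n.
move: upper; rewrite -[#|<[r]>%g|]/#[r]%g or natrM mR => upper.
rewrite -/K E2 E3.
have s1 : 3 <= Num.sqrt (2 * K * Q).
  by rewrite -(ger0_norm (ler0n R 3)) -sqrtr_sqr ler_wsqrtr //; nra.
have s2' : 5 <= Num.sqrt (1 + 4 * K * Q).
  by rewrite -(ger0_norm (ler0n R 5)) -sqrtr_sqr ler_wsqrtr //; nra.
have s3 : 2 * K * Q - 1 <= Num.sqrt ((2 * K * Q) ^+ 2 - 4 * K + 1).
  by apply: le_trans (ler_norm _) _; rewrite -sqrtr_sqr ler_wsqrtr //; nra.
lra.
Qed.
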